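(* Let $\varepsilon=\varepsilon(n)$ satisfy $\varepsilon\in\left(\omega\left(\sqrt{\frac{\log n}{n}}\right),0.001\right)$. For every randomized adaptive algorithm $\Pi$ in the adjacency-matrix query model, if on every $n$-vertex input graph $G$ the algorithm outputs, with probability $>1/100$, a clustering $\mathcal{C}'$ with $\mathrm{cost}_G(\mathcal{C}')\le \min_{\mathcal{C}}\mathrm{cost}_G(\mathcal{C})+\varepsilon n^2$, then the worst-case query complexity of $\Pi$ is $\Omega(n/\varepsilon^2)$.
   Context: Graphs are undirected, simple, on vertex set $V$ with $|V|=n$. A clustering $\mathcal{C}=(C_1,\dots,C_k)$ is a partition of $V$ into any number $k$ of parts; write $u\sim_{\mathcal{C}}v$ if $u,v$ lie in the same part. The correlation clustering cost is $\mathrm{cost}_G(\mathcal{C})=|\{\{u,v\}\notin E: u\sim_{\mathcal{C}} v\}|+|\{\{u,v\}\in E: u\not\sim_{\mathcal{C}}v\}|$ (over unordered pairs of distinct vertices). In the adjacency-matrix query model, the algorithm may adaptively query any pair $\{u,v\}$ and learn whether $\{u,v\}\in E$; each query costs one unit. Asymptotic notation is as $n\to\infty$. *)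

(* Defs.v *)
From mathcomp Require Export all_boot all_order all_algebra.
From mathcomp Require Export all_classical all_reals all_analysis.
Import Order.TTheory GRing.Theory Num.Theory.
Import numFieldNormedType.Exports.

Set Implicit Arguments.
Unset Strict Implicit.
Unset Printing Implicit Defensive.

Local Open Scope classical_set_scope.
Local Open Scope ring_scope.

Record sgraph (n : nat) := SGraph {
  adj :> rel 'I_n;
  adj_sym : symmetric adj;
  adj_irr : irreflexive adj }.

Definition clustering (n : nat) :=
  {C : {set {set 'I_n}} | finset.partition C [set: 'I_n]%SET}.

Definition same_cluster n (C : clustering n) (u v : 'I_n) : bool :=
  finset.pblock (val C) u == finset.pblock (val C) v.

(* An unordered pair of distinct vertices is represented by the pair (u, v)
   with u < v. *)
Definition cost n (G : sgraph n) (C : clustering n) : nat :=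
  (#|[set p : 'I_n * 'I_n | [&& (p.1 < p.2)%N, ~~ G p.1 p.2
                              & same_cluster C p.1 p.2]]%SET|
   + #|[set p : 'I_n * 'I_n | [&& (p.1 < p.2)%N, G p.1 p.2
                              & ~~ same_cluster C p.1 p.2]]%SET|)%N.

(* All parts are singletons; only serves as the default element of arg min. *)
Definition singletons n : clustering n :=
  exist _ (finset.preim_partition id [set: 'I_n]%SET)
          (finset.preim_partitionP id [set: 'I_n]%SET).

Definition opt_cost n (G : sgraph n) : nat :=
  cost G [arg min_(C < singletons n) cost G C]%N.

(* Deterministic adaptive algorithms: [Query u v t0 t1] asks whether {u, v} is
   an edge and goes on with t1 if it is, with t0 otherwise. *)
Inductive query_tree (n : nat) :=
| Output of clustering n
| Query of 'I_n & 'I_n & query_tree n & query_tree n.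

Fixpoint output n (t : query_tree n) (G : sgraph n) : clustering n :=
  match t with
  | Output C => C
  | Query u v t0 t1 => if G u v then output t1 G else output t0 G
  end.

Fixpoint nqueries n (t : query_tree n) (G : sgraph n) : nat :=
  match t with
  | Output _ => 0
  | Query u v t0 t1 => (if G u v then nqueries t1 G else nqueries t0 G).+1
  end.

(* The random coins w range over an arbitrary probability space; the output on
   each input is required to be a random variable. *)
Record rand_alg (R : realType) (n : nat) := RandAlg {
  ra_display : measure_display;
  ra_space : measurableType ra_display;
  ra_prob : probability ra_space R;
  ra_tree : ra_space -> query_tree n;
  ra_measurable : forall (G : sgraph n) (C : clustering n),
    measurable [set w | output (ra_tree w) G = C] }.

Definition success_prob (R : realType) n (A : rand_alg R n) (e : R)
    (G : sgraph n) : \bar R :=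
  ra_prob A [set w | (cost G (output (ra_tree w) G))%:R
                     <= (opt_cost G)%:R + e * n%:R ^+ 2].

(* Maximum over the input graphs and the random coins; it is +oo if the number
   of queries is unbounded. *)
Definition query_complexity (R : realType) n (A : rand_alg R n) : \bar R :=
  ereal_sup [set q | exists (w : ra_space A) (G : sgraph n),
                     q = ((nqueries (ra_tree w) G)%:R)%:E].

(* Main.v *)
Require Import Defs.
From mathcomp Require Import all_boot all_order all_algebra.
From mathcomp Require Import all_classical all_reals all_analysis.
From mathcomp Require Import measurable_realfun ring lra.
Import Order.TTheory GRing.Theory Num.Theory.
Import numFieldNormedType.Exports.

Set Implicit Arguments.
Unset Strict Implicit.
Unset Printing Implicit Defensive.

Local Open Scope ring_scope.

(* The hard inputs: the vertices [v >= n/2] form a core, every other vertex [u]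
   has a hidden uniform sign [x u], the pairs between [u] and the core are
   independent edges of probability [1/2 + 8 eps (x u)], and all the remaining
   pairs are fair coins.

   - Given the answers to the queries the signs stay independent, and an answer
     concerning [u] raises the expected square of the posterior mean [b u] of
     [x u] by at most [(16 eps)^2].  So after [q] queries the expectation of
     [sum_u (b u)^2] is at most [(16 eps)^2 q], and the second moment of the
     correlation between [x] and anything computed from the answers is at most
     [n (1 + (16 eps)^2 q)].
   - A clustering whose attachment of the vertices to the core has correlation
     less than [n/8] with [x] has an expected cost exceeding that of the planted
     clustering by [3/2 eps n^2], up to lower order terms.  An exponential moment
     bound and a union bound over the at most [n^n] clusterings show that the
     actual costs are close to the expected ones; this is where
     [eps >> sqrt (ln n / n)] enters.

   Hence a deterministic algorithm with few queries succeeds with small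
   probability on the random input, and so does a randomized one. *)

(** * One hidden sign and one noisy observation of it *)

Section Spin.
Variable R : realFieldType.

Definition spin (b : bool) : R := if b then 1 else -1.

Lemma spin_sqr b : spin b * spin b = 1.
Proof. by case: b; rewrite /spin; ring. Qed.

Lemma norm_spin b : `|spin b| = 1.
Proof. by case: b; rewrite /spin ?normrN normr1. Qed.

Definition mass (w : bool -> R) : R := w true + w false.
(** The mean of the sign under [w] normalised. At mass 0 it is 0 by the convention for division, so
    the sums below, weighted by the mass, stay meaningful for impossible observations. *)
Definition bias (w : bool -> R) : R := (w true - w false) / mass w.

Lemma mass_bias (w : bool -> R) : (forall b, 0 <= w b) ->
  \sum_b w b * spin b = mass w * bias w.
Proof.
move=> w0; rewrite big_bool /= /bias /mass /spin.
have [s0|s0] := eqVneq (w true + w false) 0; last by field.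
have := w0 true; have := w0 false => h1 h2.
have -> : w true = 0 by lra.
have -> : w false = 0 by lra.
by ring.
Qed.

(** The probability that a coin whose sign has mean [m * spin b] shows [c]. *)
Definition coin (m : R) (b c : bool) : R := (1 + m * spin b * spin c) / 2.

Lemma coin_ge0 m b c : `|m| <= 1 -> 0 <= coin m b c.
Proof.
rewrite ler_norml => /andP[h1 h2]; rewrite /coin /spin.
by case: b; case: c; lra.
Qed.

Lemma sum_coin m b : \sum_c coin m b c = 1.
Proof. by rewrite big_bool /= /coin /spin; case: b; field. Qed.

(* With [s] the mass and [b] the bias before the observation, the two sides are
   [s (b^2 + m^2 - 2 m^2 b^2) / (1 - m^2 b^2)] and [s (b^2 + m^2)]. *)
Lemma coin_bias_increment (m : R) (w : bool -> R) :
  `|m| < 1 -> (forall b, 0 <= w b) ->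
  \sum_c mass (fun b => w b * coin m b c) * bias (fun b => w b * coin m b c) ^+ 2
    <= mass w * (bias w ^+ 2 + m ^+ 2).
Proof.
move=> m1 w0; have := w0 true; have := w0 false => h1 h2.
have [s0|s0] := eqVneq (mass w) 0.
  rewrite /mass in s0.
  have e1 : w true = 0 by lra.
  have e2 : w false = 0 by lra.
  by rewrite big_bool /= /mass /bias e1 e2; rewrite !mul0r !addr0 !mul0r.
have sp : 0 < mass w by rewrite lt_neqAle eq_sym s0 addr_ge0.
set s := mass w in s0 sp *; set b := bias w.
have et : w true = s * (1 + b) / 2.
  by rewrite /b /bias -/s; apply: (mulIf s0); rewrite /s /mass; field; exact: s0.
have ef : w false = s * (1 - b) / 2.
  by rewrite /b /bias -/s; apply: (mulIf s0); rewrite /s /mass; field; exact: s0.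
have b1 : -1 <= b <= 1.
  apply/andP; split.
    have : 0 <= s * (1 + b) by rewrite et in h2; lra.
    by rewrite pmulr_rge0 //; lra.
  have : 0 <= s * (1 - b) by rewrite ef in h1; lra.
  by rewrite pmulr_rge0 //; lra.
have nb : `|b| <= 1 by rewrite ler_norml.
have mb : `|m * b| < 1.
  rewrite normrM; apply: le_lt_trans m1; rewrite -[leRHS]mulr1.
  by apply: ler_wpM2l.
move: mb; rewrite ltr_norml => /andP[mb1 mb2].
have p1 : 0 < 1 + m * b by lra.
have p2 : 0 < 1 - m * b by lra.
have n1 : 1 + m * b != 0 by rewrite gt_eqF.
have n2 : 1 - m * b != 0 by rewrite gt_eqF.
rewrite big_bool /= /bias /mass /coin /spin et ef.
have -> : s * (1 + b) / 2 * ((1 + m * 1 * 1) / 2) +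
   s * (1 - b) / 2 * ((1 + m * -1 * 1) / 2) = s * (1 + m * b) / 2 by field.
have -> : s * (1 + b) / 2 * ((1 + m * 1 * -1) / 2) +
   s * (1 - b) / 2 * ((1 + m * -1 * -1) / 2) = s * (1 - m * b) / 2 by field.
rewrite -subr_ge0.
set Z := (X in 0 <= X).
have -> : Z = s * (m * b) ^+ 2 * ((1 - b ^+ 2) + (1 - m ^+ 2))
              / ((1 + m * b) * (1 - m * b)).
  by rewrite /Z; field; rewrite n1 n2 s0.
have hb : b ^+ 2 <= 1 by rewrite -real_normK ?num_real // expr_le1.
have hm : m ^+ 2 <= 1 by rewrite -real_normK ?num_real // expr_le1 // ltW.
apply: divr_ge0; last by rewrite mulr_ge0 // ltW.
apply: mulr_ge0; last by lra.
by apply: mulr_ge0; [exact: ltW | exact: sqr_ge0].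
Qed.

End Spin.


(** * Second moments of independent signs *)

Section ProductLaw.
Variables (R : realFieldType) (I : finType).
Implicit Type h : I -> bool -> R.

(** For [u != v], each of the two signs is absorbed into the factor of its own vertex; the sum over
    [x] then factors, and [mass_bias] evaluates the two tilted factors. *)
Lemma sum_prod_spin2 h u v : (forall w b, 0 <= h w b) ->
  \sum_(x : {ffun I -> bool}) (\prod_w h w (x w)) * (spin R (x u) * spin R (x v))
  = (\prod_w mass (h w)) * (if u == v then 1 else bias (h u) * bias (h v)).
Proof.
move=> h0.
have [<-|uv] := eqVneq u v.
  transitivity (\prod_w \sum_b h w b).
    by rewrite bigA_distr_bigA; apply: eq_bigr => x _; rewrite spin_sqr mulr1.
  by rewrite mulr1; apply: eq_bigr => w _; rewrite big_bool.
pose h' w b := h w b * ((if w == u then spin R b else 1) *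
                        (if w == v then spin R b else 1)).
transitivity (\prod_w \sum_b h' w b).
  rewrite bigA_distr_bigA; apply: eq_bigr => x _.
  rewrite big_split; congr (_ * _).
  rewrite big_split /= -!big_mkcond /=.
  by rewrite !big_pred1_eq.
have -> : bias (h u) * bias (h v) =
    \prod_w ((if w == u then bias (h w) else 1) *
             (if w == v then bias (h w) else 1)).
  by rewrite big_split /= -!big_mkcond /= !big_pred1_eq.
rewrite -big_split; apply: eq_bigr => w _ /=; rewrite /h'.
have [->|wu] := eqVneq w u.
  rewrite (negbTE uv); under eq_bigr do rewrite mulr1.
  by rewrite mass_bias // mulr1.
have [->|wv] := eqVneq w v; under eq_bigr do rewrite mul1r.
  by rewrite mass_bias // mul1r.
by under eq_bigr do rewrite mulr1; rewrite big_bool /= !mulr1.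
Qed.

(** After expanding the square, each diagonal term contributes at most 1, and an off-diagonal one at
    most the product of two biases in absolute value, hence half the sum of their squares. *)
Lemma sum_prod_correlation_sqr h (y : I -> R) :
  (forall w b, 0 <= h w b) -> (forall u, `|y u| <= 1) ->
  \sum_(x : {ffun I -> bool})
     (\prod_w h w (x w)) * (\sum_u spin R (x u) * y u) ^+ 2
  <= (\prod_w mass (h w)) * (#|I|%:R * (1 + \sum_u bias (h u) ^+ 2)).
Proof.
move=> h0 y1.
have -> : \sum_(x : {ffun I -> bool})
     (\prod_w h w (x w)) * (\sum_u spin R (x u) * y u) ^+ 2 =
   \sum_u \sum_v y u * y v * ((\prod_w mass (h w)) *
       (if u == v then 1 else bias (h u) * bias (h v))).
  transitivity (\sum_(x : {ffun I -> bool}) \sum_u \sum_v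
     (y u * y v * ((\prod_w h w (x w)) * (spin R (x u) * spin R (x v))))).
    apply: eq_bigr => x _; rewrite expr2 mulr_suml mulr_sumr.
    apply: eq_bigr => u _; rewrite !mulr_sumr.
    by apply: eq_bigr => v _; ring.
  rewrite exchange_big; apply: eq_bigr => u _ /=.
  rewrite exchange_big; apply: eq_bigr => v _ /=.
  by rewrite -mulr_sumr sum_prod_spin2.
set M := \prod_w mass (h w).
have M0 : 0 <= M by apply: prodr_ge0 => w _; exact: addr_ge0.
apply: (@le_trans _ _ (\sum_u \sum_v M *
   ((u == v)%:R + (bias (h u) ^+ 2 + bias (h v) ^+ 2) / 2))).
  apply: ler_sum => u _; apply: ler_sum => v _.
  rewrite mulrCA; apply: ler_wpM2l => //.
  have yy : `|y u * y v| <= 1 by rewrite normrM mulr_ile1.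
  case: eqP => [_|_].
    rewrite mulr1 mulr1n; apply: (le_trans (ler_norm _)); apply: (le_trans yy).
    by rewrite lerDl divr_ge0 // addr_ge0 ?sqr_ge0.
  rewrite add0r; apply: (le_trans (ler_norm _)); rewrite normrM.
  apply: (le_trans (ler_piMl _ yy)) => //.
  rewrite normrM -(real_normK (num_real (bias (h u)))).
  rewrite -(real_normK (num_real (bias (h v)))).
  have := sqr_ge0 (`|bias (h u)| - `|bias (h v)|); lra.
rewrite le_eqVlt; apply/orP; left; apply/eqP.
under eq_bigr do
  rewrite -mulr_sumr big_split /= -mulr_suml big_split /= sumr_const.
rewrite -mulr_sumr big_split /= -mulr_suml big_split /=.
rewrite sumr_const.
have -> : \sum_i \sum_(v : I) (i == v)%:R = #|I|%:R :> R.
  rewrite -sum1_card natr_sum; apply: eq_bigr => u _.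
  rewrite (bigD1 u) //= eqxx big1 ?addr0 // => v; rewrite eq_sym => /negbTE ->.
  by [].
have -> : \sum_i bias (h i) ^+ 2 *+ #|I| = #|I|%:R * \sum_u bias (h u) ^+ 2.
  by rewrite mulr_sumr; apply: eq_bigr => u _; rewrite mulr_natl.
rewrite -mulr_natl.
have -> : #|(xpredT : pred I)| = #|I| by exact: eq_card.
by congr (_ * _); field.
Qed.

(* Only the mass function of [u] is affected by an observation concerning [u],
   so the total bias splits off the unaffected part. *)
Lemma potential_split h (h' : bool -> I -> bool -> R) u (m : R) :
  (forall w c b, w != u -> h' c w b = h w b) ->
  (forall w b, 0 <= h w b) ->
  (forall b, \sum_c h' c u b = h u b) ->
  \sum_c mass (h' c u) * bias (h' c u) ^+ 2
    <= mass (h u) * (bias (h u) ^+ 2 + m) ->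
  \sum_c (\prod_w mass (h' c w)) * (\sum_w bias (h' c w) ^+ 2) <=
  (\prod_w mass (h w)) * (\sum_w bias (h w) ^+ 2 + m).
Proof.
move=> hoff h0 hsum hb.
have massE w c : w != u -> mass (h' c w) = mass (h w).
  by move=> wu; rewrite /mass !hoff.
have biasE w c : w != u -> bias (h' c w) = bias (h w).
  by move=> wu; rewrite /bias /mass !hoff.
set P := \prod_(w | w != u) mass (h w).
set S := \sum_(w | w != u) bias (h w) ^+ 2.
have P0 : 0 <= P by apply: prodr_ge0 => w _; exact: addr_ge0.
rewrite (bigD1 u) //= -/P [in leRHS](bigD1 u) //= -/S.
have -> : \sum_c (\prod_w mass (h' c w)) * (\sum_w bias (h' c w) ^+ 2) =
   P * (\sum_c mass (h' c u) * bias (h' c u) ^+ 2) + P * S * \sum_c mass (h' c u).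
  rewrite [P * \sum_c _]mulr_sumr [P * S * _]mulr_sumr -big_split.
  apply: eq_bigr => c _ /=.
  have -> : \prod_w mass (h' c w) = mass (h' c u) * P.
    by rewrite (bigD1 u) //=; congr (_ * _); apply: eq_bigr => w /massE.
  have -> : \sum_w bias (h' c w) ^+ 2 = bias (h' c u) ^+ 2 + S.
    by rewrite (bigD1 u) //=; congr (_ + _); apply: eq_bigr => w /biasE ->.
  by ring.
have -> : \sum_c mass (h' c u) = mass (h u) by rewrite /mass big_split /= !hsum.
have := ler_wpM2l P0 hb.
by move: (mass _) (bias _) => a b; lra.
Qed.

End ProductLaw.


(** * Graphs read off tables of coins *)

Section CoinTables.
Variable n : nat.
Implicit Types (v w : 'I_n) (g : {ffun 'I_n * 'I_n -> bool}).

Definition upair v w : 'I_n * 'I_n := if (v < w)%N then (v, w) else (w, v).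

Lemma upairC v w : upair v w = upair w v.
Proof. by rewrite /upair; case: ltngtP => // /val_inj ->. Qed.

Definition table_adj g : rel 'I_n := fun v w => (v != w) && g (upair v w).

Lemma table_adj_sym g : symmetric (table_adj g).
Proof. by move=> v w; rewrite /table_adj eq_sym upairC. Qed.

Lemma table_adj_irr g : irreflexive (table_adj g).
Proof. by move=> v; rewrite /table_adj eqxx. Qed.

(** A table has a coin for every ordered pair, so that its law is a plain product; an edge is read
    from the entry with the smaller vertex first. *)
Definition table_graph g : sgraph n :=
  SGraph (@table_adj_sym g) (@table_adj_irr g).

Lemma table_graph_lt g (p : 'I_n * 'I_n) :
  (p.1 < p.2)%N -> table_graph g p.1 p.2 = g p.
Proof.
case: p => v w /= vw; rewrite /table_adj /upair vw.
by rewrite -val_eqE /= neq_ltn vw.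
Qed.

End CoinTables.

(** * The posterior law of the signs along a query tree *)

Section Posterior.
Variables (R : realFieldType) (n : nat) (mu : 'I_n * 'I_n -> R) (m : R).
Hypotheses (m_lt1 : m < 1) (mu_le : forall p, `|mu p| <= m).
Implicit Types (x : {ffun 'I_n -> bool}) (g : {ffun 'I_n * 'I_n -> bool}).
Implicit Types (rho : 'I_n * 'I_n -> pred bool).

(** The factor [2^-1 ^+ n] is the uniform law of the signs. The coin of [p] depends on the sign of
    [p.1] only, so each coin informs about a single vertex. *)
Definition joint x g : R :=
  2^-1 ^+ n * \prod_p coin (mu p) (x p.1) (g p).

Let mu_lt1 p : `|mu p| < 1. Proof. exact: le_lt_trans m_lt1. Qed.
Let mu_le1 p : `|mu p| <= 1. Proof. exact: ltW. Qed.

Lemma joint_ge0 x g : 0 <= joint x g.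
Proof.
by rewrite mulr_ge0 ?exprn_ge0 // prodr_ge0 // => p _; rewrite coin_ge0.
Qed.

(* The observed coins are described by the sets [rho p] of values which are
   still possible; [weight rho u b] is then the unnormalised posterior
   probability of [x u = b]. *)
Definition weight rho (u : 'I_n) (b : bool) : R :=
  2^-1 * \prod_v \sum_(c | rho (u, v) c) coin (mu (u, v)) b c.

Lemma weight_ge0 rho u b : 0 <= weight rho u b.
Proof.
rewrite mulr_ge0 // prodr_ge0 // => v _.
by apply: sumr_ge0 => c _; rewrite coin_ge0.
Qed.

(** The signs stay independent given the answers: the constraints concern single coins, so the sum
    over tables distributes, and grouping the coins by first vertex leaves one factor per vertex. *)
Lemma sum_joint_family rho x :
  \sum_(g in family rho) joint x g = \prod_u weight rho u (x u).
Proof.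
rewrite /weight big_split /= prodr_const card_ord -mulr_sumr.
transitivity (2^-1 ^+ n * \prod_p \sum_(c | rho p c) coin (mu p) (x p.1) c).
  by rewrite bigA_distr_big_dep.
congr (_ * _); rewrite pair_big /=.
by apply: eq_bigr => -[u v] _.
Qed.

Lemma sum_joint_mass rho :
  \sum_x \sum_(g in family rho) joint x g = \prod_u mass (weight rho u).
Proof.
transitivity (\prod_u \sum_b weight rho u b); last first.
  by apply: eq_bigr => u _; rewrite big_bool.
by rewrite bigA_distr_bigA; apply: eq_bigr => x _; exact: sum_joint_family.
Qed.

Lemma sum_jointT : \sum_x \sum_g joint x g = 1.
Proof.
transitivity (\prod_u mass (weight (fun=> predT) u)).
  rewrite -sum_joint_mass; apply: eq_bigr => x _; apply: eq_bigl => g.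
  by symmetry; apply/familyP.
apply: big1 => u _; rewrite /mass /weight.
rewrite !(big1 _ _ (fun v => \sum_(c | _) _)) ?mulr1; first by field.
all: by move=> v _; exact: sum_coin.
Qed.

(** The knowledge after coin [p] has shown [c]; if [rho] already excludes [c] at [p], no table
    remains. *)
Definition observe rho p c : 'I_n * 'I_n -> pred bool :=
  fun p' d => rho p' d && ((p' == p) ==> (d == c)).

Lemma mem_observe rho p c g :
  (g \in family (observe rho p c)) = (g \in family rho) && (g p == c).
Proof.
apply/familyP/andP => [h|[/familyP h /eqP gp] p'].
  split; last by have /andP[_] := h p; rewrite eqxx.
  by apply/familyP => p'; have /andP[] := h p'.
rewrite unfold_in /observe; apply/andP; split; first exact: h.
by apply/implyP => /eqP ->; rewrite gp.
Qed.

Lemma sum_observe rho p (F : {ffun 'I_n * 'I_n -> bool} -> R) :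
  \sum_(g in family rho) F g =
  \sum_c \sum_(g in family (observe rho p c)) F g.
Proof.
rewrite (partition_big (fun g => g p) predT) //=.
by apply: eq_bigr => c _; apply: eq_bigl => g; rewrite mem_observe.
Qed.

Lemma weight_observe_off rho p c u b :
  u != p.1 -> weight (observe rho p c) u b = weight rho u b.
Proof.
move=> up; congr (_ * _); apply: eq_bigr => v _; apply: eq_bigl => d.
rewrite /observe; case: eqP => [e|_]; last by rewrite andbT.
by rewrite -e eqxx in up.
Qed.

Lemma weight_split rho p b :
  weight rho p.1 b = 2^-1 *
    (\prod_(v | v != p.2) \sum_(c | rho (p.1, v) c) coin (mu (p.1, v)) b c) *
    \sum_(c | rho p c) coin (mu p) b c.
Proof. by rewrite /weight (bigD1 p.2) //= -surjective_pairing; ring. Qed.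

Lemma weight_observe rho p c b :
  weight (observe rho p c) p.1 b = 2^-1 *
    (\prod_(v | v != p.2) \sum_(c | rho (p.1, v) c) coin (mu (p.1, v)) b c) *
    ((rho p c)%:R * coin (mu p) b c).
Proof.
rewrite weight_split; congr (_ * _ * _).
  apply: eq_bigr => v vp; apply: eq_bigl => d; rewrite /observe.
  case: eqP => [e|_]; last by rewrite andbT.
  by rewrite -e eqxx in vp.
rewrite (eq_bigl (fun d => (d == c) && rho p c)); last first.
  by move=> d; rewrite /observe eqxx /= andbC; case: eqP => // ->.
by rewrite big_mkcondr /= big_pred1_eq; case: (rho p c); rewrite ?mul1r ?mul0r.
Qed.

Lemma sum_weight_observe rho p b :
  \sum_c weight (observe rho p c) p.1 b = weight rho p.1 b.
Proof.
under eq_bigr do rewrite weight_observe.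
rewrite -mulr_sumr weight_split; congr (_ * _).
rewrite [RHS]big_mkcond; apply: eq_bigr => c _.
by case: (rho p c); rewrite ?mul1r ?mul0r.
Qed.

(** While both values of the coin are possible, seeing [c] multiplies the weights of [p.1] by
    [coin (mu p) b c], so that [coin_bias_increment] applies. *)
Lemma bias_observe rho p :
  \sum_c mass (weight (observe rho p c) p.1) *
         bias (weight (observe rho p c) p.1) ^+ 2
  <= mass (weight rho p.1) * (bias (weight rho p.1) ^+ 2 + m ^+ 2).
Proof.
have massE w w' : w =1 w' -> mass w = mass w' :> R.
  by move=> e; rewrite /mass !e.
have biasE w w' : w =1 w' -> bias w = bias w' :> R.
  by move=> e; rewrite /bias /mass !e.
have mass_bias0 : mass (fun=> 0 : R) * bias (fun=> 0) ^+ 2 = 0.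
  by rewrite /mass addr0 mul0r.
have W0 : 0 <= mass (weight rho p.1) by rewrite addr_ge0 // weight_ge0.
have [full|nfull] := boolP (rho p true && rho p false).
  have rhoT c : rho p c by move: full; case: c => /andP[].
  have rhoE b : \sum_(c | rho p c) coin (mu p) b c = 1.
    by rewrite (eq_bigl predT) ?sum_coin // => c; rewrite rhoT.
  have obsE c : weight (observe rho p c) p.1 =1
      fun b => weight rho p.1 b * coin (mu p) b c.
    by move=> b; rewrite weight_observe weight_split rhoE rhoT mulr1n; ring.
  under eq_bigr do rewrite (massE _ _ (obsE _)) (biasE _ _ (obsE _)).
  apply: (le_trans (coin_bias_increment (mu_lt1 p) _)).
    by move=> b; exact: weight_ge0.
  apply: ler_wpM2l => //; rewrite lerD2l -real_normK ?num_real //.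
  by rewrite lerXn2r // nnegrE ?normr_ge0 // (le_trans _ (mu_le p)).
(* A coin whose value is already known brings no information. *)
have [c0 hc0] : exists c0, ~~ rho p c0.
  by move: nfull; rewrite negb_and => /orP[]; [exists true|exists false].
have z : weight (observe rho p c0) p.1 =1 fun=> 0.
  by move=> b; rewrite weight_observe (negbTE hc0) mulr0n mul0r mulr0.
have s : weight (observe rho p (~~ c0)) p.1 =1 weight rho p.1.
  move=> b; rewrite -[RHS]sum_weight_observe big_bool /=.
  by case: (c0) z => /= z; rewrite z ?addr0 ?add0r.
have -> : \sum_c mass (weight (observe rho p c) p.1) *
         bias (weight (observe rho p c) p.1) ^+ 2 =
   mass (weight rho p.1) * bias (weight rho p.1) ^+ 2.
  rewrite big_bool /=; case: (c0) z s => /= z s;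
  rewrite (massE _ _ z) (biasE _ _ z) (massE _ _ s) (biasE _ _ s) mass_bias0;
  by rewrite ?addr0 ?add0r.
by rewrite mulrDr lerDl mulr_ge0 // sqr_ge0.
Qed.

(** Induction on the tree for arbitrary knowledge [rho]. At a leaf the clustering is fixed and
    [sum_prod_correlation_sqr] applies; at a query the branches split the mass, and the growth of
    the potential is paid by the one additional query. *)
Lemma correlation_sqr_tree (y : clustering n -> 'I_n -> R) (t : query_tree n)
    rho :
  (forall C u, `|y C u| <= 1) ->
  \sum_x \sum_(g in family rho) joint x g *
     (\sum_u spin R (x u) * y (output t (table_graph g)) u) ^+ 2
  <= (\prod_u mass (weight rho u)) *
        (n%:R * (1 + \sum_u bias (weight rho u) ^+ 2))
     + n%:R * m ^+ 2 * \sum_x \sum_(g in family rho)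
         joint x g * (nqueries t (table_graph g))%:R.
Proof.
move=> y1; elim: t rho => [C|v w t0 IH0 t1 IH1] rho /=.
  under eq_bigr do rewrite -mulr_suml sum_joint_family.
  apply: le_trans (sum_prod_correlation_sqr _ _) _ => //.
    by move=> *; exact: weight_ge0.
  rewrite card_ord lerDl; apply: mulr_ge0; first by rewrite mulr_ge0 ?sqr_ge0.
  apply: sumr_ge0 => x _; apply: sumr_ge0 => g _.
  by rewrite mulr_ge0 ?joint_ge0.
(* A vertex is never adjacent to itself, so this query leads to [t0] and leaves [rho] unchanged. *)
have [<-|vw] := eqVneq v w.
  under eq_bigr do under eq_bigr do rewrite table_adj_irr.
  apply: le_trans (IH0 rho) _; rewrite lerD2l; apply: ler_wpM2l.
    by rewrite mulr_ge0 ?sqr_ge0.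
  apply: ler_sum => x _; apply: ler_sum => g _.
  by rewrite table_adj_irr ler_wpM2l ?joint_ge0 // ler_nat.
set p := upair v w.
have adjE g : table_adj g v w = g p by rewrite /table_adj vw.
pose T c := if c then t1 else t0.
pose N c := \sum_x \sum_(g in family (observe rho p c))
               joint x g * (nqueries (T c) (table_graph g))%:R.
pose M c := \prod_u mass (weight (observe rho p c) u).
pose B c := \sum_u bias (weight (observe rho p c) u) ^+ 2.
have -> : \sum_x \sum_(g in family rho) joint x g *
    (\sum_u spin R (x u) * y (if table_adj g v w
        then output t1 (table_graph g) else output t0 (table_graph g)) u) ^+ 2 =
  \sum_c \sum_x \sum_(g in family (observe rho p c)) joint x g *
    (\sum_u spin R (x u) * y (output (T c) (table_graph g)) u) ^+ 2.
  rewrite [RHS]exchange_big; apply: eq_bigr => x _ /=.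
  rewrite (sum_observe rho p); apply: eq_bigr => c _; apply: eq_bigr => g.
  rewrite mem_observe adjE => /andP[_ /eqP ->].
  by case: (c).
have -> : \sum_x \sum_(g in family rho) joint x g *
    ((if table_adj g v w then nqueries t1 (table_graph g)
      else nqueries t0 (table_graph g)).+1)%:R =
    \sum_c N c + \prod_u mass (weight rho u).
  rewrite -sum_joint_mass /N [X in _ = X + _]exchange_big -[RHS]big_split.
  apply: eq_bigr => x _ /=.
  under eq_bigr do rewrite -natr1 mulrDr mulr1.
  rewrite big_split /=; congr (_ + _).
  rewrite (sum_observe rho p); apply: eq_bigr => c _; apply: eq_bigr => g.
  rewrite mem_observe adjE => /andP[_ /eqP ->].
  by case: (c).
have IH c : \sum_x \sum_(g in family (observe rho p c)) joint x g *
    (\sum_u spin R (x u) * y (output (T c) (table_graph g)) u) ^+ 2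
    <= M c * (n%:R * (1 + B c)) + n%:R * m ^+ 2 * N c.
  by case: c; [exact: IH1|exact: IH0].
apply: (@le_trans _ _
    (\sum_c (M c * (n%:R * (1 + B c)) + n%:R * m ^+ 2 * N c))).
  by apply: ler_sum => c _; exact: IH.
have sumM : \sum_c M c = \prod_u mass (weight rho u).
  rewrite -sum_joint_mass (eq_bigr _ (fun x _ => sum_observe rho p _)).
  by rewrite exchange_big; apply: eq_bigr => c _; rewrite sum_joint_mass.
have : \sum_c M c * B c <= (\prod_u mass (weight rho u)) *
    (\sum_u bias (weight rho u) ^+ 2 + m ^+ 2).
  apply: potential_split (bias_observe rho p).
  - by move=> u c b; exact: weight_observe_off.
  - exact: weight_ge0.
  - exact: sum_weight_observe.
rewrite -sumM; move: (\sum_u bias (weight rho u) ^+ 2) => B0.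
rewrite !big_bool /= => h.
have := ler_wpM2l (ler0n R n) h.
lra.
Qed.

End Posterior.


(** * Exponential moments of independent coins *)

Lemma expR_le_quadratic (R : realType) (t : R) :
  `|t| <= 2^-1 -> expR t <= 1 + t + 2 * t ^+ 2.
Proof.
rewrite ler_norml => /andP[t1 t2].
have pos : 0 < 1 - t by lra.
have : expR t <= (1 - t)^-1.
  rewrite -[t in expR t]opprK expRN lef_pV2 ?posrE ?expR_gt0 //.
  exact: expR_ge1Dx.
move=> /le_trans; apply.
rewrite -div1r ler_pdivrMr //.
(* This product is [(1 - t) * (1 + t + 2 * t ^+ 2) - 1]. *)
have : 0 <= t ^+ 2 * (1 - 2 * t) by rewrite mulr_ge0 ?sqr_ge0 //; lra.
lra.
Qed.

(** The deviation is centred, so the linear term of the quadratic bound vanishes and the variance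
    [1 - m ^+ 2] remains. As the deviation is at most 2, [A <= 4^-1] keeps the exponent within the
    range of that bound. *)
Lemma coin_mgf (R : realType) (m a A : R) (b : bool) :
  `|m| <= 1 -> `|a| <= A -> A <= 4^-1 ->
  \sum_c coin m b c * expR (a * (spin R c - m * spin R b))
    <= expR (2 * A ^+ 2).
Proof.
move=> m1 aA A4.
have mb : `|m * spin R b| <= 1 by rewrite normrM norm_spin mulr1.
have small c : `|a * (spin R c - m * spin R b)| <= 2^-1.
  rewrite normrM; have : `|spin R c - m * spin R b| <= 2.
    by apply: (le_trans (ler_normB _ _)); rewrite norm_spin; lra.
  move=> h; apply: (@le_trans _ _ (4^-1 * 2)); last by lra.
  by apply: ler_pM => //; lra.
apply: (@le_trans _ _ (1 + 2 * A ^+ 2)); last exact: expR_ge1Dx.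
apply: (@le_trans _ _ (\sum_c coin m b c * (1 + a * (spin R c - m * spin R b)
    + 2 * (a * (spin R c - m * spin R b)) ^+ 2))).
  apply: ler_sum => c _; apply: ler_wpM2l; first exact: coin_ge0.
  exact: expR_le_quadratic.
have -> : \sum_c coin m b c * (1 + a * (spin R c - m * spin R b)
    + 2 * (a * (spin R c - m * spin R b)) ^+ 2) = 1 + 2 * a ^+ 2 * (1 - m ^+ 2).
  by rewrite big_bool /= /coin /spin; case: b {mb small}; field.
rewrite lerD2l -mulrA; apply: ler_wpM2l => //.
apply: (@le_trans _ _ (a ^+ 2)).
  by rewrite ler_piMr ?sqr_ge0 // gerBl sqr_ge0.
by rewrite -real_normK ?num_real // lerXn2r // nnegrE (le_trans _ aA).
Qed.

(** Chernoff's method: the indicator is at most the exponential of the sum minus [tau], whose mean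
    factors into [n ^ 2] single-coin moments. *)
Lemma coin_table_tail (R : realType) (n : nat) (mu a : 'I_n * 'I_n -> R)
    (A tau : R) (x : {ffun 'I_n -> bool}) :
  (forall p, `|mu p| <= 1) -> (forall p, `|a p| <= A) -> A <= 4^-1 ->
  \sum_(g : {ffun 'I_n * 'I_n -> bool})
     (\prod_p coin (mu p) (x p.1) (g p)) *
     (tau <= \sum_p a p * (spin R (g p) - mu p * spin R (x p.1)))%R%:R
  <= expR (2 * A ^+ 2 * n%:R ^+ 2 - tau).
Proof.
move=> mu1 aA A4.
apply: (@le_trans _ _ (\sum_(g : {ffun 'I_n * 'I_n -> bool}) expR (- tau) *
   \prod_p (coin (mu p) (x p.1) (g p) *
            expR (a p * (spin R (g p) - mu p * spin R (x p.1)))))).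
  apply: ler_sum => g _; rewrite [in leRHS]big_split /= mulrCA; apply: ler_wpM2l.
    by apply: prodr_ge0 => p _; exact: coin_ge0.
  rewrite -expR_sum -expRD.
  case: (leP tau) => h; last by rewrite mulr0n expR_ge0.
  by rewrite mulr1n -expR0 ler_expR; lra.
rewrite -mulr_sumr addrC expRD; apply: ler_wpM2l; first exact: expR_ge0.
rewrite -(bigA_distr_bigA (fun p c => coin (mu p) (x p.1) c *
            expR (a p * (spin R c - mu p * spin R (x p.1))))) /=.
apply: (@le_trans _ _ (\prod_(p : 'I_n * 'I_n) expR (2 * A ^+ 2))).
  apply: ler_prod => p _; apply/andP; split; last exact: coin_mgf.
  by apply: sumr_ge0 => c _; rewrite mulr_ge0 ?coin_ge0 ?expR_ge0.
rewrite prodr_const card_prod card_ord -expRM_natl ler_expR.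
by rewrite natrM expr2 [leLHS]mulrC.
Qed.

(** * Counting clusterings, and the cost in terms of signs *)

Section Clusterings.
Variable n : nat.
Implicit Type C : clustering n.

Lemma same_cluster_mem C u v :
  same_cluster C u v = (v \in finset.pblock (val C) u).
Proof.
have /and3P[/eqP cov tI _] := valP C.
by rewrite /same_cluster eq_pblock // cov finset.in_setT.
Qed.

Lemma same_cluster_inj C C' :
  same_cluster C =2 same_cluster C' -> C = C'.
Proof.
move=> e; apply: val_inj.
rewrite -(equivalence_partition_pblock (valP C)).
rewrite -(equivalence_partition_pblock (valP C')).
apply: eq_imset => u; apply/finset.setP => v; rewrite !inE.
by rewrite -!same_cluster_mem e.
Qed.

(** The choice depends on the cluster of [u] alone, so this map determines the clustering; hence the
    bound [n ^ n] on their number. *)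
Definition representative C : {ffun 'I_n -> 'I_n} :=
  [ffun u => odflt u [pick v in finset.pblock (val C) u]].

Lemma same_clusterE C u v :
  same_cluster C u v = (representative C u == representative C v).
Proof.
have repP w : same_cluster C w (representative C w).
  rewrite same_cluster_mem ffunE; case: pickP => //= /(_ w).
  by rewrite -same_cluster_mem /same_cluster eqxx.
apply/idP/eqP => [/eqP e|e].
  rewrite !ffunE e; case: pickP => //= /(_ v).
  by rewrite -same_cluster_mem /same_cluster eqxx.
by have := repP u; have := repP v; rewrite e /same_cluster => /eqP-> /eqP->.
Qed.

Lemma card_clustering : (#|{: clustering n}| <= n ^ n)%N.
Proof.
rewrite -[in leqRHS](card_ord n) -card_ffun.
apply: (@leq_card _ _ representative) => C C' e.
by apply: same_cluster_inj => u v; rewrite !same_clusterE e.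
Qed.

Definition label_clustering (f : 'I_n -> bool) : clustering n :=
  exist _ (finset.preim_partition f [set: 'I_n]%SET)
          (finset.preim_partitionP f [set: 'I_n]%SET).

Lemma same_label_clustering f u v :
  same_cluster (label_clustering f) u v = (f u == f v).
Proof.
rewrite same_cluster_mem pblock_equivalence_partition ?inE //.
by move=> a b c _ _ _; split=> // /eqP ->.
Qed.

(** A pair is a disagreement exactly when its two signs are opposite. This makes the cost affine in
    the edge signs. *)
Lemma cost_spin (R : realFieldType) (G : sgraph n) C :
  (cost G C)%:R = \sum_(p : 'I_n * 'I_n | (p.1 < p.2)%N)
     (1 - spin R (G p.1 p.2) * spin R (same_cluster C p.1 p.2)) / 2.
Proof.
rewrite /cost natrD !cardsE -!sum1_card !natr_sum.
rewrite big_mkcond [X in _ + X]big_mkcond [RHS]big_mkcond -big_split /=.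
apply: eq_bigr => p _; rewrite !unfold_in.
by case: ltnP => _; case: (G _ _); case: (same_cluster _ _ _);
  rewrite /= /spin ?addr0 //; field.
Qed.

Lemma opt_cost_le (G : sgraph n) C : (opt_cost G <= cost G C)%N.
Proof. by rewrite /opt_cost; case: arg_minnP => // C' _ ->. Qed.

End Clusterings.


(** * The hard input distribution *)

Section HardInstance.
Variables (R : realType) (n : nat) (e : R).
Hypotheses (n_ge8 : (8 <= n)%N) (e_gt0 : 0 < e) (e_lt : e < 1000^-1).
Implicit Types (x : {ffun 'I_n -> bool}) (g : {ffun 'I_n * 'I_n -> bool}).
Implicit Type C : clustering n.

Let k : nat := n./2.

(* [hard_mu p * spin R (x p.1)] is the mean of the sign of the coin of [p]. *)
Definition hard_mu (p : 'I_n * 'I_n) : R :=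
  16 * e * ((p.1 < k) && (k <= p.2))%N%:R.

(** It joins a vertex outside the core to the core exactly when their edges have probability above
    one half. *)
Definition planted x : clustering n :=
  label_clustering (fun u => (k <= u)%N || x u).

(** A relaxed guess of [x u] in [[-1, 1]]: 1 if [u] is clustered with the whole core, -1 if with
    none of it. *)
Definition attachment C (u : 'I_n) : R :=
  if (u < k)%N then
    (\sum_(v : 'I_n | (k <= v)%N) spin R (same_cluster C u v)) / (n - k)%:R
  else 0.

Let k_le : (k <= n)%N.
Proof. by rewrite /k -[leqRHS]odd_double_half -addnn addnCA leq_addr. Qed.

Let k_lt : (k < n)%N.
Proof.
rewrite /k ltn_half_double -addnn -[ltnLHS]addn0 ltn_add2l.
exact: leq_trans n_ge8.
Qed.

Let card_lt : \sum_(u < n | (u < k)%N) 1 = k%:R :> R.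
Proof. by rewrite -(big_ord_widen n (fun=> 1)) // sumr_const card_ord. Qed.

Let card_ge : \sum_(u < n | (k <= u)%N) 1 = (n - k)%:R :> R.
Proof.
rewrite natrB // -card_lt.
have -> : n%:R = \sum_(u < n) 1 :> R by rewrite sumr_const card_ord.
rewrite [X in X - _](bigID (fun u : 'I_n => (u < k)%N)) /= addrAC subrr add0r.
by apply: eq_bigl => u; rewrite -leqNgt.
Qed.

Let nk_gt0 : 0 < (n - k)%:R :> R.
Proof. by rewrite ltr0n subn_gt0. Qed.

Lemma hard_mu_le p : `|hard_mu p| <= 16 * e.
Proof.
rewrite /hard_mu normrM ger0_norm; last by rewrite mulr_ge0 // ltW.
rewrite -[leRHS]mulr1; apply: ler_wpM2l; first by rewrite mulr_ge0 // ltW.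
by case: (_ && _); rewrite ?normr1 ?normr0.
Qed.

Lemma attachment_le1 C u : `|attachment C u| <= 1.
Proof.
rewrite /attachment; case: ifP => _; last by rewrite normr0.
rewrite normrM normfV [`|(n - k)%:R|]ger0_norm // ler_pdivrMr // mul1r.
apply: (le_trans (ler_norm_sum _ _ _)); rewrite -card_ge.
by apply: ler_sum => v _; rewrite norm_spin.
Qed.

(** Half of this is the coefficient of the edge sign of [p] in the cost of the planted clustering
    minus that of [C]. *)
Definition advantage C x (p : 'I_n * 'I_n) : R :=
  if (p.1 < p.2)%N then
    spin R (same_cluster C p.1 p.2) - spin R (same_cluster (planted x) p.1 p.2)
  else 0.

Lemma advantage_le2 C x p : `|advantage C x p| <= 2.
Proof.
rewrite /advantage; case: ifP => _; last by rewrite normr0.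
by apply: (le_trans (ler_normB _ _)); rewrite !norm_spin.
Qed.

Definition noise C x g : R :=
  \sum_p advantage C x p * (spin R (g p) - hard_mu p * spin R (x p.1)).

(** Only pairs between [u] outside the core and [v] in the core have biased coins. There the planted
    sign is [x u], whose product with itself is 1; the sum over [v] yields the attachment of [u]. *)
Lemma mean_advantage C x :
  \sum_p advantage C x p * (hard_mu p * spin R (x p.1)) =
  16 * e * (n - k)%:R * (\sum_u spin R (x u) * attachment C u - k%:R).
Proof.
transitivity (\sum_(u < n) \sum_(v < n)
    advantage C x (u, v) * (hard_mu (u, v) * spin R (x u))).
  by rewrite pair_big; apply: eq_bigr => -[u v].
have -> : \sum_u spin R (x u) * attachment C u =
    \sum_(u < n | (u < k)%N) spin R (x u) * attachment C u.
  rewrite [RHS]big_mkcond; apply: eq_bigr => u _; rewrite /attachment.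
  by case: ifP => _; rewrite ?mulr0.
rewrite -card_lt -sumrB mulr_sumr [RHS]big_mkcond; apply: eq_bigr => u _ /=.
rewrite /hard_mu /=; case: ltnP => uk /=; last first.
  by apply: big1 => v _; rewrite !mulr0 mul0r mulr0.
transitivity (\sum_(v < n | (k <= v)%N)
    16 * e * (spin R (x u) * spin R (same_cluster C u v) - 1)).
  rewrite [RHS]big_mkcond; apply: eq_bigr => v _.
  case: ifP => kv; last by rewrite !mulr0 mul0r mulr0.
  rewrite /advantage /= (leq_trans uk kv) same_label_clustering kv leqNgt uk /=.
  have -> : spin R (x u == true) = spin R (x u) by case: (x u).
  rewrite mulr1n mulr1; have := spin_sqr R (x u).
  by move: (spin R _) (spin R _) => s t h; ring: h.
rewrite -mulr_sumr sumrB -mulr_sumr card_ge /attachment uk.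
by field; rewrite gt_eqF.
Qed.

Lemma cost_planted_sub C x g :
  (cost (table_graph g) (planted x))%:R - (cost (table_graph g) C)%:R =
  (noise C x g + 16 * e * (n - k)%:R *
     (\sum_u spin R (x u) * attachment C u - k%:R)) / 2.
Proof.
rewrite -mean_advantage -big_split !(cost_spin R) -sumrB big_mkcond mulr_suml.
apply: eq_bigr => p _ /=; rewrite /advantage.
case: ifP => [lt|_]; last by rewrite !mul0r addr0 mul0r.
by have /= -> := table_graph_lt g lt; field.
Qed.

Definition succeeds C g : bool :=
  (cost (table_graph g) C)%:R <= (opt_cost (table_graph g))%:R + e * n%:R ^+ 2.

Lemma succeeds_dichotomy C x g : succeeds C g ->
  (n%:R / 8 <= \sum_u spin R (x u) * attachment C u) \/
  (e * n%:R ^+ 2 / 2 <= noise C x g).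
Proof.
move=> suc; case: leP => h; [by left|right].
have opt : (opt_cost (table_graph g))%:R <=
    (cost (table_graph g) (planted x))%:R :> R.
  by rewrite ler_nat opt_cost_le.
have gap := cost_planted_sub C x g.
have kE : k%:R * 2 = n%:R - (odd n)%:R :> R.
  by rewrite -[in n%:R](odd_double_half n) natrD -muln2 natrM; ring.
have odd1 : (odd n)%:R <= 1 :> R by case: (odd n).
have odd0 : 0 <= (odd n)%:R :> R by [].
have n8 : 8 <= n%:R :> R by rewrite (ler_nat R 8).
move: suc gap; rewrite /succeeds natrB //.
move: (noise _ _ _) (\sum_u _) h opt => N S h opt suc gap.
have a1 : n%:R / 2 <= n%:R - k%:R :> R by lra.
(* Rounding in [k] loses at most [1 / 2 <= n / 16], and [1 / 2 - 1 / 16 - 1 / 8 = 5 / 16]. *)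
have a2 : 5 / 16 * n%:R <= k%:R - S by lra.
have a3 : n%:R / 2 * (5 / 16 * n%:R) <= (n%:R - k%:R) * (k%:R - S).
  by apply: ler_pM => //; lra.
have := ler_wpM2l (ltW e_gt0) a3.
lra.
Qed.

(** Chebyshev's inequality at threshold [n / 8], applied to the second moment from
    [correlation_sqr_tree]. *)
Lemma correlation_tail (t : query_tree n) (q : R) :
  (forall G, (nqueries t G)%:R <= q) ->
  \sum_x \sum_g joint hard_mu x g * (n%:R / 8 <=
      \sum_u spin R (x u) * attachment (output t (table_graph g)) u)%R%:R
  <= 64 / n%:R * (1 + (16 * e) ^+ 2 * q).
Proof.
move=> tq.
have n0 : 0 < n%:R :> R by rewrite ltr0n (leq_trans _ n_ge8).
have e16 : 16 * e < 1 by move: e_lt => e1; lra.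
have jt0 x g : 0 <= joint hard_mu x g by apply: joint_ge0 hard_mu_le x g.
have := correlation_sqr_tree e16 hard_mu_le t (fun=> predT) attachment_le1.
have famT (F : {ffun 'I_n * 'I_n -> bool} -> R) :
    \sum_(g in family (fun=> predT)) F g = \sum_g F g.
  by apply: eq_bigl => g; apply/familyP.
rewrite -(sum_joint_mass hard_mu (fun=> predT)).
under eq_bigr do rewrite famT.
rewrite (eq_bigr _ (fun x _ => famT (joint hard_mu x))) sum_jointT.
(* Before any query both values of each sign are equally likely, so the potential starts at 0. *)
have -> : \sum_u bias (weight hard_mu (fun=> predT) u) ^+ 2 = 0.
  apply: big1 => u _; rewrite /bias (_ : _ - _ = 0) ?mul0r ?expr0n //.
  rewrite /weight; under eq_bigr do rewrite sum_coin.
  by under [X in _ - _ * X]eq_bigr do rewrite sum_coin; rewrite subrr.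
under [X in _ <= _ + _ * X]eq_bigr do rewrite famT.
move=> h.
have Nq : \sum_x \sum_g joint hard_mu x g * (nqueries t (table_graph g))%:R <= q.
  rewrite -[leRHS]mul1r -[X in X * q](sum_jointT hard_mu) mulr_suml.
  apply: ler_sum => x _; rewrite mulr_suml; apply: ler_sum => g _.
  by apply: ler_wpM2l.
apply: (@le_trans _ _ (64 / n%:R ^+ 2 * (\sum_x \sum_g joint hard_mu x g *
   (\sum_u spin R (x u) * attachment (output t (table_graph g)) u) ^+ 2))).
  rewrite mulr_sumr; apply: ler_sum => x _; rewrite mulr_sumr.
  apply: ler_sum => g _; rewrite mulrCA; apply: ler_wpM2l => //.
  case: (leP (n%:R / 8)) => S8.
    rewrite mulr1n mulrAC ler_pdivlMr ?exprn_gt0 // mul1r.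
    have : (n%:R / 8) ^+ 2 <= (\sum_u spin R (x u) *
        attachment (output t (table_graph g)) u) ^+ 2.
      rewrite lerXn2r // nnegrE ?divr_ge0 ?ltW //.
      by rewrite (lt_le_trans _ S8) // divr_gt0.
    by rewrite expr_div_n; lra.
  by rewrite mulr0n mulr_ge0 ?sqr_ge0 // divr_ge0 ?exprn_ge0 // ltW.
apply: (@le_trans _ _ (64 / n%:R ^+ 2 * (n%:R + n%:R * (16 * e) ^+ 2 * q))).
  apply: ler_wpM2l; first by rewrite divr_ge0 // exprn_ge0 // ltW.
  apply: (le_trans h); rewrite addr0 mulr1 mul1r lerD2l.
  by apply: ler_wpM2l => //; rewrite mulr_ge0 ?sqr_ge0 // ltW.
by rewrite le_eqVlt; apply/orP; left; apply/eqP; field; rewrite gt_eqF.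
Qed.

Lemma noise_tail C x :
  \sum_g joint hard_mu x g * (e * n%:R ^+ 2 / 2 <= noise C x g)%R%:R
  <= 2^-1 ^+ n * expR (- (e ^+ 2 * n%:R ^+ 2 / 128)).
Proof.
under eq_bigr do rewrite /joint -[2^-1 ^+ n * _ * _]mulrA.
rewrite -mulr_sumr; apply: ler_wpM2l; first by rewrite exprn_ge0.
have mu1 p : `|hard_mu p| <= 1.
  by apply: (le_trans (hard_mu_le p)); move: e_lt => e1; lra.
(* The scale [e / 32] minimises the Chernoff exponent [8 * s ^+ 2 * n ^ 2 - s * e * n ^ 2 / 2] over
   [s]. *)
have aA p : `|e / 32 * advantage C x p| <= e / 16.
  rewrite normrM ger0_norm; last by rewrite divr_ge0 // ltW.
  have := ler_wpM2l (_ : 0 <= e / 32) (advantage_le2 C x p).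
  by move=> /(_ (divr_ge0 (ltW e_gt0) _)) h; apply: le_trans (h _) _ => //; lra.
have := coin_table_tail (e ^+ 2 * n%:R ^+ 2 / 64) x mu1 aA.
have -> : 2 * (e / 16) ^+ 2 * n%:R ^+ 2 - e ^+ 2 * n%:R ^+ 2 / 64
  = - (e ^+ 2 * n%:R ^+ 2 / 128) by field.
move=> h; apply: le_trans (h _); last by move: e_lt => e1; lra.
apply: ler_sum => g _; apply: ler_wpM2l.
  by apply: prodr_ge0 => p _; exact: coin_ge0.
case: (leP (e * n%:R ^+ 2 / 2)) => // hn; rewrite mulr1n.
suff -> : e ^+ 2 * n%:R ^+ 2 / 64 <= \sum_p e / 32 * advantage C x p *
   (spin R (g p) - hard_mu p * spin R (x p.1)) by [].
under eq_bigr do rewrite -mulrA.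
rewrite -mulr_sumr -/(noise C x g).
have := ler_wpM2l (ltW e_gt0) hn; lra.
Qed.

(** The output depends on the table, so the noise event of [succeeds_dichotomy] is bounded by its
    sum over all clusterings, while the correlation event is controlled for the actual output. *)
Lemma deterministic_success (t : query_tree n) (q : R) :
  (forall G, (nqueries t G)%:R <= q) ->
  \sum_x \sum_g joint hard_mu x g * (succeeds (output t (table_graph g)) g)%:R
  <= 64 / n%:R * (1 + (16 * e) ^+ 2 * q)
     + n%:R ^+ n * expR (- (e ^+ 2 * n%:R ^+ 2 / 128)).
Proof.
move=> tq.
have e16 : 16 * e < 1 by move: e_lt => e1; lra.
have jt0 x g : 0 <= joint hard_mu x g by apply: joint_ge0 hard_mu_le x g.
have noiseU : \sum_C \sum_x \sum_g joint hard_mu x g *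
     (e * n%:R ^+ 2 / 2 <= noise C x g)%R%:R
    <= n%:R ^+ n * expR (- (e ^+ 2 * n%:R ^+ 2 / 128)).
  apply: (@le_trans _ _ (\sum_(C : clustering n) \sum_x
      2^-1 ^+ n * expR (- (e ^+ 2 * n%:R ^+ 2 / 128)))).
    by apply: ler_sum => C _; apply: ler_sum => x _; exact: noise_tail.
  rewrite sumr_const sumr_const card_ffun card_bool card_ord.
  rewrite -[_ *+ 2 ^ n]mulr_natl -[_ *+ #|_|]mulr_natl natrX.
  rewrite [2 ^+ n * _]mulrA -exprMn divff // expr1n mul1r.
  by apply: ler_wpM2r; [exact: expR_ge0|rewrite -natrX ler_nat card_clustering].
apply: le_trans (lerD (correlation_tail tq) noiseU).
rewrite [X in _ <= _ + X]exchange_big /= -[leRHS]big_split.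
apply: ler_sum => x _ /=.
rewrite [X in _ <= _ + X]exchange_big /= -[leRHS]big_split.
apply: ler_sum => g _ /=.
rewrite -mulr_sumr -mulrDr; apply: ler_wpM2l => //.
set C := output t _.
have sum0 : 0 <= \sum_C (e * n%:R ^+ 2 / 2 <= noise C x g)%R%:R :> R.
  by apply: sumr_ge0.
case: (boolP (succeeds C g)) => [suc|_]; last by rewrite addr_ge0.
case: (succeeds_dichotomy x suc) => h; first by rewrite h lerDl.
rewrite (bigD1 C) //= h addrCA lerDl addr_ge0 //.
by apply: sumr_ge0.
Qed.

End HardInstance.


(** * Choice of parameters and randomised algorithms *)

Lemma union_bound_le_inv (R : realType) (n : nat) (e : R) : (0 < n)%N ->
  ln (n%:R : R) / n%:R <= e ^+ 2 / 256 ->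
  n%:R ^+ n * expR (- (e ^+ 2 * n%:R ^+ 2 / 128)) <= n%:R^-1.
Proof.
move=> n0 he.
have n0R : 0 < n%:R :> R by rewrite ltr0n.
have n1R : 1 <= n%:R :> R by rewrite ler1n.
have {1}-> : n%:R = expR (ln n%:R) :> R by rewrite lnK // posrE.
have -> : n%:R^-1 = expR (- ln n%:R) :> R by rewrite expRN lnK // posrE.
rewrite -expRM_natl -expRD ler_expR.
(* By [he] the negative exponent is at least [2 * n * ln n] in size, which absorbs the [n * ln n] of
   the union bound and leaves at most [- ln n]. *)
have := ler_wpM2l (sqr_ge0 (n%:R : R)) he.
have -> : n%:R ^+ 2 * (ln n%:R / n%:R) = n%:R * ln n%:R :> R.
  by field; rewrite gt_eqF.
have l0 : 0 <= ln n%:R :> R by exact: ln_ge0.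
have := ler_wpM2r l0 n1R.
lra.
Qed.

(** The averaging half of Yao's principle: integrate the bound for fixed coins [t] and exchange the
    integral with the finite sum over inputs. *)
Lemma weighted_probability_le (R : realType) (d : measure_display)
    (T : measurableType d) (P : probability T R) (I : finType) (w : I -> R)
    (S : I -> set T) (a : R) :
  (forall i, 0 <= w i) -> (forall i, measurable (S i)) ->
  (forall t, \sum_i w i * (\1_(S i) t) <= a) ->
  \sum_i w i * fine (P (S i)) <= a.
Proof.
move=> w0 mS wa; rewrite -lee_fin -sumEFin.
have indic_ge0 i t : (0 <= (\1_(S i) t : R)%:E)%E by rewrite lee_fin indicE.
have mindic i : measurable_fun [set: T]%classic
      ((fun t => (\1_(S i) t)%:E) : T -> \bar R).
  by apply/measurable_EFinP; exact: measurable_indic.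
have mterm i : measurable_fun [set: T]%classic
      ((fun t => (w i)%:E * (\1_(S i) t)%:E)%E : T -> \bar R).
  by apply: measurable_funeM; exact: mindic.
have term_ge0 i t : (0 <= (w i)%:E * (\1_(S i) t)%:E)%E.
  by rewrite mule_ge0 // lee_fin.
have -> : (\sum_i (w i * fine (P (S i)))%:E =
    \int[P]_t (\sum_i (w i)%:E * (\1_(S i) t)%:E))%E.
  rewrite ge0_integral_sum //; apply: eq_bigr => i _.
  rewrite ge0_integralZl_EFin // integral_indic // setIT EFinM fineK //.
  exact: fin_num_measure.
rewrite -[leRHS]mule1 -(probability_setT P) -integral_cst //.
apply: ge0_le_integral => //.
- by move=> t _; apply: sume_ge0.
- by apply: emeasurable_sum.
- by move=> t _; rewrite sumEFin lee_fin.
Qed.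

Local Open Scope classical_set_scope.

Lemma measurable_output_pred (R : realType) (n : nat) (A : rand_alg R n)
    (G : sgraph n) (Q : pred (clustering n)) :
  measurable [set w : ra_space A | Q (output (ra_tree w) G)].
Proof.
have -> : [set w : ra_space A | Q (output (ra_tree w) G)] =
    \bigcup_(C in [set C | Q C]) [set w : ra_space A | output (ra_tree w) G = C].
  apply/seteqP; split => [w Qw|w [C QC /= ->]//].
  by exists (output (ra_tree w) G).
apply: fin_bigcup_measurable; first exact: finite_finset.
by move=> C _; exact: ra_measurable.
Qed.

(** Otherwise the success probability averaged over the hard inputs would be at least [1 / 100],
    while for every outcome of the coins the tree is deterministic and [deterministic_success] gives
    less. *)
Lemma few_queries_fail (R : realType) (n : nat) (e q : R) (A : rand_alg R n) :
  (8 <= n)%N -> 0 < e -> e < 1000^-1 ->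
  (forall (w : ra_space A) G, (nqueries (ra_tree w) G)%:R <= q) ->
  64 / n%:R * (1 + (16 * e) ^+ 2 * q)
    + n%:R ^+ n * expR (- (e ^+ 2 * n%:R ^+ 2 / 128)) < 1 / 100 ->
  exists G, (success_prob A e G <= (1 / 100)%:E)%E.
Proof.
move=> n8 e0 e1 Aq small; apply: contrapT => noG.
have success G : ((1 / 100)%:E < success_prob A e G)%E.
  by rewrite ltNge; apply/negP => h; apply: noG; exists G.
pose w (i : {ffun 'I_n -> bool} * {ffun 'I_n * 'I_n -> bool}) :=
  joint (hard_mu e) i.1 i.2.
pose S (i : {ffun 'I_n -> bool} * {ffun 'I_n * 'I_n -> bool}) :=
  [set r | succeeds e (output (ra_tree (r : ra_space A)) (table_graph i.2)) i.2].
have mS i : measurable (S i).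
  exact: (measurable_output_pred A (table_graph i.2) (fun C => succeeds e C i.2)).
have w0 i : 0 <= w i.
  by apply: joint_ge0 (hard_mu_le e0) _ _; lra.
have wle t : \sum_i w i * \1_(S i) t <=
    64 / n%:R * (1 + (16 * e) ^+ 2 * q)
    + n%:R ^+ n * expR (- (e ^+ 2 * n%:R ^+ 2 / 128)).
  apply: le_trans (deterministic_success n8 e0 e1 (Aq t)).
  rewrite pair_big /= le_eqVlt; apply/orP; left; apply/eqP.
  apply: eq_bigr => i _; rewrite indicE; congr (_ * (nat_of_bool _)%:R).
  by apply/idP/idP => [/set_mem|h]; last exact/mem_set.
have := weighted_probability_le (ra_prob A) w0 mS wle.
have : 1 / 100 <= \sum_i w i * fine (ra_prob A (S i)).
  have -> : 1 / 100 = \sum_i w i * (1 / 100) :> R.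
    rewrite -mulr_suml.
    have -> : \sum_i w i = \sum_x \sum_g joint (@hard_mu R n e) x g.
      by rewrite pair_big.
    by rewrite sum_jointT [RHS]mul1r.
  apply: ler_sum => i _; apply: ler_wpM2l => //.
  rewrite -lee_fin fineK; first exact/ltW/success.
  exact: fin_num_measure.
by lra.
Qed.

Theorem theorem4p1 (R : realType) (eps : nat -> R)
  (eps_omega : (fun n : nat => Num.sqrt (ln (n%:R : R) / n%:R)) =o_\oo eps)
  (eps_bounds : \forall n \near \oo, 0 < eps n < 1 / 1000)
  (Pi : forall n : nat, rand_alg R n)
  (Pi_correct : \forall n \near \oo, forall G : sgraph n,
     ((1 / 100)%:E < success_prob (Pi n) (eps n) G)%E) :
  exists2 c : R, 0 < c &
    \forall n \near \oo,
      ((c * (n%:R / eps n ^+ 2))%:E <= query_complexity (Pi n))%E.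
Proof.
(* With this constant the information term [64 * 16 ^ 2 * 256^-1 ^+ 3] equals [1024^-1]. *)
exists (256^-1 ^+ 3); first by rewrite exprn_gt0.
(* The factor [16^-1] squares to the [1 / 256] required by [union_bound_le_inv]. *)
have small := (eqoP _ _ _).1 eps_omega 16^-1 ltac:(by []).
near=> n.
(* The terms [64 / n] and [1 / n] then add up to at most [1 / 200], which with [1 / 1024] stays
   below [1 / 100]. *)
have n_large : (130 * 100 : R) <= n%:R by near: n; exact: nbhs_infty_ger.
have /andP[e0 e1] : 0 < eps n < 1 / 1000 by near: n.
have n0 : 0 < n%:R :> R by lra.
have lnn : ln (n%:R : R) / n%:R <= eps n ^+ 2 / 256.
  have : `|Num.sqrt (ln (n%:R : R) / n%:R)| <= 16^-1 * `|eps n| by near: n.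
  rewrite ger0_norm ?sqrtr_ge0 // gtr0_norm // => h.
  have l0 : 0 <= ln (n%:R : R) / n%:R.
    by rewrite divr_ge0 ?ln_ge0 //; lra.
  rewrite -(sqr_sqrtr l0).
  have := ler_pM (sqrtr_ge0 _) (sqrtr_ge0 _) h h; rewrite -!expr2; lra.
rewrite leNgt; apply/negP => few.
have [] : exists G, (success_prob (Pi n) (eps n) G <= (1 / 100)%:E)%E.
  apply: (@few_queries_fail _ _ _ (256^-1 ^+ 3 * (n%:R / eps n ^+ 2))) => //.
  - by rewrite -(ler_nat R); lra.
  - by rewrite -div1r.
  - move=> w G; rewrite -lee_fin; apply/ltW; apply: le_lt_trans few.
    by apply: ereal_sup_ubound; exists w, G.
  have := union_bound_le_inv (_ : (0 < n)%N) lnn.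
  rewrite -(ltr_nat R) => /(_ n0) => hu.
  have -> : 64 / n%:R * (1 + (16 * eps n) ^+ 2 *
      (256^-1 ^+ 3 * (n%:R / eps n ^+ 2))) = 64 / n%:R + 1024^-1.
    by field; rewrite !gt_eqF.
  have : n%:R^-1 <= (130 * 100)^-1 :> R by rewrite lef_pV2 // posrE; lra.
  lra.
move=> G; apply/negP; rewrite -ltNge.
by move: G; near: n.
Unshelve. all: by end_near.
Qed.
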